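(* Suppose that for all fixed $m,b$ and $N$ sufficiently large, $f_N(m, b+1)<f_N(m, b)<f_N(m+1, b)$, with both differences tending to infinity as $N\to\infty$. Then for fixed $p$ and $n$ sufficiently large, the $(p,2p+1)$-biased Clique game on $K_n$ is won by player $2$.
   Context: Two players, Alice (player 1, starting) and Bob (player 2), alternately colour uncoloured edges of the complete graph $K_n$, Alice in red and Bob in blue; in the $(p,q)$-biased version Alice colours $p$ edges per turn and Bob $q$ edges per turn. In the Clique game, Alice's score is $a=\omega(G[A])$ and Bob's is $b=\omega(G[B])$, the clique numbers of the red and blue graphs; when $q>p$, Bob (player 2) wins if at the end $b>a$. For the Maker–Breaker clique game, $f_N(m,b)$ denotes the largest $q$ such that Maker can occupy a $K_q$ in the $(m:b)$ game (Maker claims $m$ edges, Breaker $b$ edges per turn) played on $K_N$. *)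

(* Defs.v *)
From mathcomp Require Import all_boot.
From mathcomp Require Import boolp.

Set Implicit Arguments.
Unset Strict Implicit.
Unset Printing Implicit Defensive.

Section BiasedGame.
Variables (T : finType) (board : {set T}).

Definition free (X Y : {set T}) : {set T} := board :\: (X :|: Y).

(* A turn claims exactly k free elements, or all of them if fewer than k
   are left. *)
Definition legal (k : nat) (X Y S : {set T}) : bool :=
  (S \subset free X Y) && (#|S| == minn k #|free X Y|).

(* forces k l W turn X Y: from the position where the protagonist owns X and
   the opponent owns Y, the protagonist (bias k) has a strategy against every
   play of the opponent (bias l) such that the final position, with the whole
   board claimed, satisfies W. The protagonist is the next to move iff turn is
   true. *)
Inductive forces (k l : nat) (W : {set T} -> {set T} -> Prop) :
    bool -> {set T} -> {set T} -> Prop :=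
| Forces_end turn X Y :
    free X Y = set0 -> W X Y -> forces k l W turn X Y
| Forces_self X Y S :
    free X Y != set0 -> legal k X Y S -> forces k l W false (X :|: S) Y ->
    forces k l W true X Y
| Forces_opponent X Y :
    free X Y != set0 ->
    (forall S, legal l X Y S -> forces k l W true X (Y :|: S)) ->
    forces k l W false X Y.

End BiasedGame.

Definition edges (n : nat) : {set {set 'I_n}} :=
  [set e : {set 'I_n} | #|e| == 2].

Definition clique (n : nat) (A : {set {set 'I_n}}) (Q : {set 'I_n}) : bool :=
  [forall x in Q, forall y in Q, (x != y) ==> ([set x; y] \in A)].

(* The clique number of the graph with vertex set 'I_n and edge set A. *)
Definition clique_number (n : nat) (A : {set {set 'I_n}}) : nat :=
  \max_(Q : {set 'I_n} | clique A Q) #|Q|.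

(* The (m:b) Maker-Breaker game on K_N in which Maker, who moves first, wants
   a clique on q vertices. *)
Definition maker_can_occupy (N m b q : nat) : Prop :=
  forces (edges N) m b
    (fun M _ => exists Q : {set 'I_N}, clique M Q /\ #|Q| = q)
    true set0 set0.

(* f_N(m,b); no clique of K_N has more than N vertices, hence the range. *)
Definition maker_clique (N m b : nat) : nat :=
  \max_(q < N.+1 | `[< maker_can_occupy N m b q >]) q.

(* Player 2 wins the (p,q)-biased Clique game on K_n, for q > p, a regime in
   which he needs a strictly larger clique. The protagonist of forces is
   player 2, and player 1 moves first. *)
Definition player2_wins_clique_game (n p q : nat) : Prop :=
  forces (edges n) q p
    (fun B A => clique_number A < clique_number B)
    false set0 set0.

Definition tends_to_infinity (u : nat -> nat) : Prop :=
  forall K, exists N0, forall N, N0 <= N -> K <= u N.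

(* Main.v *)
(** Bob splits his [2p+1] edges per turn into [p+1] edges with which he plays
    Breaker against Alice's cliques and [p] edges with which he plays Maker
    against Alice's [p] edges.  Extra edges never hurt in a monotone game, so
    the two strategies can be played simultaneously.  As Breaker he keeps
    Alice's clique number at most [f_n(p,p+1)].  As Maker he moves second; he
    pretends that Alice's first [p] edges are his own, and at the end deletes
    one vertex of each of them from his clique, which therefore has at least
    [f_n(p,p) - p] vertices.  The hypothesis makes [f_n(p,p) - f_n(p,p+1)]
    exceed [p] for large [n]. *)

Require Import Defs.
From mathcomp Require Import all_boot.
From mathcomp Require Import boolp.

Set Implicit Arguments.
Unset Strict Implicit.
Unset Printing Implicit Defensive.

(** Serves both to pad a move to its legal size and to cut a clique down to a prescribed size. *)
Lemma card_interpolate (T : finType) (A B : {set T}) m :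
  A \subset B -> #|A| <= m <= #|B| ->
  exists C : {set T}, [/\ A \subset C, C \subset B & #|C| = m].
Proof.
move=> sAB /andP[leAm]; elim: m leAm => [|m IHm] leAm lemB.
  by exists A; split=> //; apply/eqP; rewrite -leqn0.
move: leAm; rewrite leq_eqVlt => /orP[/eqP eqAm|ltAm].
  by exists A; split.
have [C [sAC sCB cardC]] := IHm ltAm (ltnW lemB).
have /properP[_ [x Bx Cx]] : C \proper B by rewrite properEcard sCB cardC.
exists (x |: C); split.
- exact: subset_trans sAC (subsetUr _ _).
- by rewrite subUset sub1set Bx.
- by rewrite cardsU1 Cx cardC.
Qed.

(** * Biased games on a finite board: determinacy, strategy transfer and simultaneous play *)

Section Games.
Variables (T : finType) (board : {set T}).
Implicit Types (X Y S D : {set T}) (W : {set T} -> {set T} -> Prop).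

Local Notation free := (free board).
Local Notation legal := (legal board).
Local Notation forces := (forces board).

Lemma freeC X Y : free X Y = free Y X.
Proof. by rewrite /Defs.free setUC. Qed.

Lemma legalC k X Y S : legal k X Y S = legal k Y X S.
Proof. by rewrite /Defs.legal freeC. Qed.

Lemma in_free X Y x :
  (x \in free X Y) = [&& x \in board, x \notin X & x \notin Y].
Proof. by rewrite !inE negb_or andbC. Qed.

Lemma legal_extend k X Y S :
  S \subset free X Y -> #|S| <= k ->
  exists2 S' : {set T}, S \subset S' & legal k X Y S'.
Proof.
move=> sSF leSk.
have [|S' [sSS' sS'F cardS']] := @card_interpolate _ _ _ (minn k #|free X Y|) sSF.
  by rewrite leq_min leSk subset_leq_card // geq_minr.
by exists S' => //; rewrite /Defs.legal sS'F cardS' eqxx.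
Qed.

Lemma legal_exists k X Y : exists S, legal k X Y S.
Proof.
have [||S _ legalS] := @legal_extend k X Y set0; rewrite ?sub0set ?cards0 //.
by exists S.
Qed.

Lemma legal_sub k X Y S : legal k X Y S -> S \subset free X Y.
Proof. by case/andP. Qed.

Lemma legal_card k X Y S : legal k X Y S -> #|S| <= k.
Proof. by case/andP=> _ /eqP->; apply: geq_minl. Qed.

Lemma card_free_self k X Y S :
  0 < k -> free X Y != set0 -> legal k X Y S ->
  #|free (X :|: S) Y| < #|free X Y|.
Proof.
move=> k_gt0 nzF /andP[sSF /eqP cardS].
have -> : free (X :|: S) Y = free X Y :\: S.
  by apply/setP=> x; rewrite !inE; do !case: (x \in _).
rewrite cardsDS // ltn_subrL cardS card_gt0 nzF andbT.
by rewrite leq_min k_gt0 card_gt0.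
Qed.

Lemma card_free_opponent k X Y S :
  0 < k -> free X Y != set0 -> legal k X Y S ->
  #|free X (Y :|: S)| < #|free X Y|.
Proof.
by rewrite legalC !(freeC X) => k_gt0 nzF; apply: card_free_self.
Qed.

Lemma forces_ended k l W t X Y : free X Y = set0 -> forces k l W t X Y -> W X Y.
Proof.
move=> F0 win; case: win F0 => [? ? ? _ //|? ? ? nzF _ _ F0|? ? nzF _ F0];
  by rewrite F0 eqxx in nzF.
Qed.

Lemma forces_self_inv k l W X Y :
  free X Y != set0 -> forces k l W true X Y ->
  exists2 S, legal k X Y S & forces k l W false (X :|: S) Y.
Proof.
move=> nzF; move Et: true => t win.
case: win Et nzF => [? ? ? -> _ _ /eqP //|? ? S _ legalS winS _ _|//].
by exists S.
Qed.

Lemma forces_opponent_inv k l W X Y :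
  free X Y != set0 -> forces k l W false X Y ->
  forall S, legal l X Y S -> forces k l W true X (Y :|: S).
Proof.
move=> nzF; move Et: false => t win.
by case: win Et nzF => [? ? ? -> _ _ /eqP //|//|].
Qed.

Section PositiveBias.
Variables k l : nat.
Hypotheses (k_gt0 : 0 < k) (l_gt0 : 0 < l).

(** Arbitrary legal play ends, since each turn shrinks the free set, and the opponent can only gain
    elements outside [X]. *)
Lemma forces_always W t X Y :
  (forall X' Y', X \subset X' -> Y' \subset Y :|: (board :\: X) -> W X' Y') ->
  forces k l W t X Y.
Proof.
have [m] := ubnP #|free X Y|; elim: m => // m IHm in t X Y *.
rewrite ltnS => leFm winW.
have [F0|nzF] := eqVneq (free X Y) set0.
  by apply: Forces_end => //; apply: winW => //; apply: subsetUl.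
case: t.
  have [S legalS] := legal_exists k X Y.
  apply: (Forces_self nzF legalS); apply: IHm.
    exact: leq_trans (card_free_self k_gt0 nzF legalS) leFm.
  move=> X' Y' sXS sY'; apply: winW.
    exact: subset_trans (subsetUl _ _) sXS.
  by apply: subset_trans sY' _; rewrite setUS // setDS // subsetUl.
apply: (Forces_opponent nzF) => S legalS; apply: IHm.
  exact: leq_trans (card_free_opponent l_gt0 nzF legalS) leFm.
move=> X' Y' sX sY'; apply: winW => //; apply: subset_trans sY' _.
rewrite -setUA setUS // subUset subxx andbT.
apply/subsetP=> x /(subsetP (legal_sub legalS)).
by rewrite in_free inE => /and3P[-> ->].
Qed.

(** Backward induction on the number of free elements, with classical logic supplying a refuting
    move for the opponent at his turns. *)
Lemma determinacy W t X Y :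
  ~ forces k l W t X Y ->
  Defs.forces board l k (fun B A => ~ W A B) (~~ t) Y X.
Proof.
have [m] := ubnP #|free X Y|; elim: m => // m IHm in t X Y *.
rewrite ltnS => leFm lose.
have [F0|nzF] := eqVneq (free X Y) set0.
  by apply: Forces_end; rewrite 1?freeC // => winW; apply/lose/Forces_end.
have nzF' : free Y X != set0 by rewrite freeC.
case: t lose => lose /=.
  apply: (Forces_opponent nzF') => S; rewrite legalC => legalS.
  apply: (IHm false).
    exact: leq_trans (card_free_self k_gt0 nzF legalS) leFm.
  by move=> win; apply/lose/(Forces_self nzF legalS).
have [S legalS loseS] :
    exists2 S, legal l X Y S & ~ forces k l W true X (Y :|: S).
  apply: contrapT => noS; apply/lose/(Forces_opponent nzF) => S legalS.
  by apply: contrapT => loseS; apply: noS; exists S.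
apply: (@Forces_self _ _ _ _ _ _ _ S nzF'); first by rewrite legalC.
apply: (IHm true) => //.
exact: leq_trans (card_free_opponent l_gt0 nzF legalS) leFm.
Qed.

(* The protagonist at [(X', Y')] follows the strategy for the imaginary
   position [(X, Y)]; the elements of [D], already claimed in the real game,
   may count as his in the imaginary one. *)
Lemma forces_transfer D W W' t X Y X' Y' :
  (forall X1 Y1 X2 Y2, X1 \subset X2 :|: D -> Y2 \subset Y1 :|: D ->
     W X1 Y1 -> W' X2 Y2) ->
  D \subset X' :|: Y' -> X \subset X' :|: D -> Y' \subset Y :|: D ->
  forces k l W t X Y -> forces k l W' t X' Y'.
Proof.
move=> WW' sD sX sY win.
elim: win X' Y' sD sX sY => {t X Y}
    [t X Y F0 winW|X Y S nzF legalS _ IH|X Y nzF _ IH] X' Y'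
    /subsetP sD /subsetP sX /subsetP sY.
(* The imaginary game is over, so any continuation of the real one will do: outside [D], whatever
   the protagonist still lacks belongs to [Y]. *)
- apply: forces_always => X2 Y2 /subsetP sX2 /subsetP sY2.
  apply: (WW' X Y) => //; apply/subsetP => x.
    by move/sX; rewrite !inE => /orP[/sX2|] ->; rewrite ?orbT.
  move/sY2; rewrite inE => /orP[/sY //|].
  rewrite !inE => /andP[X'x bx].
  case Dx: (x \in D); rewrite ?orbT // orbF.
  apply: contraFT (in_set0 x) => Yx; rewrite -F0 in_free bx Yx andbT.
  by apply: contra X'x => /sX; rewrite inE Dx orbF.
- have freeS x : x \in S -> x \in board /\ x \notin Y.
    by move/(subsetP (legal_sub legalS)); rewrite in_free => /and3P[].
  (* If the real board is already full, each element of [S] lies in [X'] or in [D], so the imaginary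
     move needs no real counterpart. *)
  have [F'0|nzF'] := eqVneq (free X' Y') set0.
    apply: Forces_end => //; apply: (forces_ended (t := false) F'0).
    apply: IH; apply/subsetP => // x.
    rewrite inE => /orP[/sX //|/freeS[bx Yx]].
    move/setP/(_ x): F'0; rewrite in_free bx !inE /=.
    case: (x \in X') => //= /negbT/negPn/sY.
    by rewrite inE (negPf Yx).
  (* Only this part of the imaginary move has to be played for real; the turn is then filled up
     arbitrarily. *)
  have sSF : S :\: (X' :|: D) \subset free X' Y'.
    apply/subsetP => x; rewrite in_free !inE negb_or.
    case/andP=> /andP[X'x Dx] /freeS[bx Yx]; rewrite bx X'x /=.
    by apply: contra Yx => /sY; rewrite inE (negPf Dx) orbF.
  have [|S' /subsetP sSS' legalS'] := legal_extend (k := k) sSF.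
    apply: leq_trans (legal_card legalS).
    by rewrite subset_leq_card // subsetDl.
  apply: (Forces_self nzF' legalS'); apply: IH; apply/subsetP => x.
  + by move/sD; rewrite !inE => /orP[] ->; rewrite ?orbT.
  + rewrite inE => /orP[/sX|Sx]; first by rewrite !inE => /orP[] ->; rewrite ?orbT.
    have := sSS' x; rewrite !inE Sx andbT.
    by case: (x \in X') => //=; case: (x \in D); rewrite ?orbT //= => ->.
  + exact: sY.
- have [F'0|nzF'] := eqVneq (free X' Y') set0.
    (* The real game is over; an arbitrary imaginary opponent move only enlarges [Y], which
       preserves the domination. *)
    have [S legalS] := legal_exists l X Y.
    apply: Forces_end => //; apply: (forces_ended (t := true) F'0).
    apply: (IH S legalS); apply/subsetP => // x.
    by move/sY; rewrite !inE => /orP[] ->; rewrite ?orbT.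
  apply: (Forces_opponent nzF') => S legalS.
  have freeS x : x \in S -> [/\ x \in board, x \notin X' & x \notin Y'].
    by move/(subsetP (legal_sub legalS)); rewrite in_free => /and3P[].
  (* Elements of the real move that the imaginary opponent already owns are replaced by arbitrary
     free ones, given to him in advance. *)
  have sSF : S :\: Y \subset free X Y.
    apply/subsetP => x; rewrite in_free inE => /andP[Yx /freeS[bx X'x Y'x]].
    rewrite bx Yx andbT /=; apply: contra X'x => /sX.
    rewrite inE => /orP[//|/sD].
    by rewrite inE (negPf Y'x) orbF.
  have [|S' /subsetP sSS' legalS'] := legal_extend (k := l) sSF.
    apply: leq_trans (legal_card legalS).
    by rewrite subset_leq_card // subsetDl.
  apply: (IH S' legalS'); apply/subsetP => x.
  + by move/sD; rewrite !inE => /orP[] ->; rewrite ?orbT.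
  + exact: sX.
  + rewrite inE => /orP[/sY|Sx]; first by rewrite !inE => /orP[] ->; rewrite ?orbT.
    have := sSS' x; rewrite !inE Sx andbT.
    by case: (x \in Y) => //= ->.
Qed.

End PositiveBias.

Definition monotone_goal W :=
  forall X Y X' Y', X \subset X' -> Y' \subset Y -> W X Y -> W X' Y'.

Lemma forces_weaken k l W W' t X Y X' Y' :
  0 < k -> 0 < l ->
  (forall X1 Y1 X2 Y2, X1 \subset X2 -> Y2 \subset Y1 -> W X1 Y1 -> W' X2 Y2) ->
  X \subset X' -> Y' \subset Y -> forces k l W t X Y -> forces k l W' t X' Y'.
Proof.
move=> k_gt0 l_gt0 WW' sX sY; apply: (@forces_transfer _ _ k_gt0 l_gt0 set0) => //.
- by move=> X1 Y1 X2 Y2; rewrite !setU0; apply: WW'.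
- exact: sub0set.
- by rewrite setU0.
- by rewrite setU0.
Qed.

(** The union of the two prescribed moves, padded to legal size, is played in one turn. To each
    strategy the rest of the turn is a gift, harmless for a monotone goal. *)
Lemma forces_both k1 k2 l W1 W2 t X Y :
  0 < k1 -> 0 < k2 -> 0 < l -> monotone_goal W1 -> monotone_goal W2 ->
  forces k1 l W1 t X Y -> forces k2 l W2 t X Y ->
  forces (k1 + k2) l (fun X Y => W1 X Y /\ W2 X Y) t X Y.
Proof.
move=> k1_gt0 k2_gt0 l_gt0 mono1 mono2.
have [m] := ubnP #|free X Y|; elim: m => // m IHm in t X Y *.
rewrite ltnS => leFm win1 win2.
have [F0|nzF] := eqVneq (free X Y) set0.
  by apply: Forces_end => //; split; [move: win1|move: win2]; apply: forces_ended.
case: t win1 win2 => win1 win2; last first.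
  apply: (Forces_opponent nzF) => S legalS; apply: IHm.
  - exact: leq_trans (card_free_opponent l_gt0 nzF legalS) leFm.
  - exact: forces_opponent_inv nzF win1 S legalS.
  - exact: forces_opponent_inv nzF win2 S legalS.
have [S1 legal1 {}win1] := forces_self_inv nzF win1.
have [S2 legal2 {}win2] := forces_self_inv nzF win2.
have [||S] := @legal_extend (k1 + k2) X Y (S1 :|: S2).
- by rewrite subUset (legal_sub legal1) (legal_sub legal2).
- apply: leq_trans (leq_add (legal_card legal1) (legal_card legal2)).
  by rewrite cardsU leq_subr.
rewrite subUset => /andP[sS1 sS2] legalS.
have k_gt0 : 0 < k1 + k2 by rewrite addn_gt0 k1_gt0.
apply: (Forces_self nzF legalS); apply: IHm.
- exact: leq_trans (card_free_self k_gt0 nzF legalS) leFm.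
- by apply: (forces_weaken _ _ mono1) win1; rewrite ?setUS.
- by apply: (forces_weaken _ _ mono2) win2; rewrite ?setUS.
Qed.

End Games.

(** * Clique numbers and the effect of removing a few edges *)

Section Cliques.
Variable n : nat.
Implicit Types (A B D : {set {set 'I_n}}) (Q : {set 'I_n}).

Lemma cliqueP A Q :
  reflect {in Q &, forall x y, x != y -> [set x; y] \in A} (clique A Q).
Proof.
apply: (iffP forall_inP) => [cl x y Qx Qy|cl x Qx].
  by have /forall_inP/(_ y Qy)/implyP := cl x Qx.
by apply/forall_inP=> y Qy; apply/implyP; apply: cl.
Qed.

Lemma cliqueS A B Q Q' :
  A \subset B -> Q' \subset Q -> clique A Q -> clique B Q'.
Proof.
move=> /subsetP sAB /subsetP sQ /cliqueP cl; apply/cliqueP=> x y Qx Qy neq.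
by apply/sAB/cl => //; apply: sQ.
Qed.

Lemma clique_set0 A : clique A set0.
Proof. by apply/cliqueP=> x y; rewrite inE. Qed.

Lemma leq_clique_number A Q : clique A Q -> #|Q| <= clique_number A.
Proof. by move=> clA; apply: (bigmax_sup Q). Qed.

Lemma clique_number_le A B : A \subset B -> clique_number A <= clique_number B.
Proof.
move=> sAB; apply/bigmax_leqP => Q clA.
exact/leq_clique_number/(cliqueS sAB _ clA).
Qed.

Lemma clique_of_size A q :
  q <= clique_number A -> exists Q : {set 'I_n}, clique A Q /\ #|Q| = q.
Proof.
have [Q0 cl0 ->] : {Q0 | clique A Q0 & clique_number A = #|Q0|}.
  apply: (eq_bigmax_cond (A := clique A)).
  by apply/card_gt0P; exists set0; apply: clique_set0.
move=> leq0.
have [|Q [_ sQ cardQ]] := @card_interpolate _ set0 Q0 q (sub0set _).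
  by rewrite cards0.
by exists Q; split=> //; apply: cliqueS (subxx _) sQ cl0.
Qed.

Lemma clique_number_setU A D Q :
  clique (A :|: D) Q -> #|Q| <= clique_number A + #|D|.
Proof.
move/cliqueP=> cl.
(* One chosen endpoint per edge of [D]: an edge of [D] inside [Q :\: R] would have its chosen
   endpoint in [R]. *)
pose R := [set x | [exists e in D, [pick y in e] == Some x]].
have leRD : #|R| <= #|D|.
  rewrite -(card_imset (mem R) (@Some_inj _)).
  apply: leq_trans (leq_imset_card (fun e : {set 'I_n} => [pick y in e]) (mem D)).
  apply/subset_leq_card/subsetP => _ /imsetP[x + ->].
  by rewrite inE => /exists_inP[e De /eqP <-]; apply: imset_f.
have clR : clique A (Q :\: R).
  apply/cliqueP=> x y /setDP[Qx Rx] /setDP[Qy Ry] neq.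
  have := cl x y Qx Qy neq; rewrite inE => /orP[//|Dxy].
  have : x \in [set x; y] by rewrite !inE eqxx.
  case Epick: [pick z in [set x; y]] => [z|] xy; last first.
    by case: pickP Epick => // /(_ x); rewrite xy.
  have Rz : z \in R by rewrite inE; apply/exists_inP; exists [set x; y]; rewrite ?Epick.
  case: pickP Epick => // z' + [Ez]; rewrite Ez !inE => /orP[] /eqP Exy.
    by rewrite -Exy Rz in Rx.
  by rewrite -Exy Rz in Ry.
rewrite -(cardsID R Q) addnC leq_add ?leq_clique_number //.
by apply: leq_trans leRD; rewrite subset_leq_card // subsetIr.
Qed.

End Cliques.

(** * What the value of [maker_clique] gives each player *)

Section MakerClique.
Variables N m b : nat.
Hypotheses (m_gt0 : 0 < m) (b_gt0 : 0 < b).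

Lemma maker_clique_occupy : maker_can_occupy N m b (maker_clique N m b).
Proof.
pose occ (q : 'I_N.+1) := `[< maker_can_occupy N m b q >].
have [q /asboolP occq ->] : {q | occ q & maker_clique N m b = q}.
  apply: (eq_bigmax_cond (A := occ)); apply/card_gt0P; exists ord0; apply/asboolP.
  apply: forces_always => // X Y _ _.
  (* The size 0 is always attainable, so the maximum is taken over a nonempty range and is
     attained. *)
  by exists set0; rewrite clique_set0 cards0.
exact: occq.
Qed.

Lemma maker_clique_le : maker_clique N m b <= N.
Proof. by apply/bigmax_leqP => q _; rewrite -ltnS. Qed.

(** Maker cannot force one vertex more than the maximum, so by determinacy Breaker can prevent it.
    The strict bound by [N] keeps that size within the range of the maximum. *)
Lemma breaker_bounds_clique :
  maker_clique N m b < N ->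
  forces (edges N) b m (fun B A => clique_number A <= maker_clique N m b)
    false set0 set0.
Proof.
set q := maker_clique N m b => ltqN.
have cannot : ~ maker_can_occupy N m b q.+1.
  move=> occ; suff : q < q by rewrite ltnn.
  by apply: (bigmax_sup (Ordinal (ltqN : q.+1 < N.+1))) => //; apply/asboolP.
apply: forces_weaken (determinacy m_gt0 b_gt0 cannot) => //.
move=> X1 Y1 X2 Y2 _ sY noclique; rewrite leqNgt; apply/negP => ltqY.
(* Breaker's goal excludes only cliques of size exactly [q.+1], but a larger clique contains one. *)
apply: noclique; apply: clique_of_size.
exact: leq_trans ltqY (clique_number_le sY).
Qed.

Lemma maker_moves_second :
  forces (edges N) m b
    (fun M _ => maker_clique N m b <= clique_number M + b) false set0 set0.
Proof.
pose W (M B : {set {set 'I_N}}) :=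
  exists Q : {set 'I_N}, clique M Q /\ #|Q| = maker_clique N m b.
have WD (D X1 Y1 X2 : {set {set 'I_N}}) : #|D| <= b -> X1 \subset X2 :|: D ->
    W X1 Y1 -> maker_clique N m b <= clique_number X2 + b.
  move=> leDb sX [Q [clQ <-]].
  apply: leq_trans (clique_number_setU (cliqueS sX (subxx _) clQ)) _.
  by rewrite leq_add2l.
have win : forces (edges N) m b W true set0 set0 := maker_clique_occupy.
have [F0|nzF] := eqVneq (free (edges N) set0 set0) set0.
  (* Without any edge on the board there is no opening move to imagine away. *)
  apply: Forces_end => //.
  by apply: (WD set0 set0) (forces_ended F0 win); rewrite ?cards0 ?sub0set.
apply: (Forces_opponent nzF) => S legalS; rewrite set0U.
(* The imaginary position is the empty board with Maker to move; the opening [S] counts as Maker's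
   whenever his strategy asks for it. *)
apply: (forces_transfer m_gt0 b_gt0 (D := S)) win; rewrite ?set0U ?sub0set //.
move=> X1 Y1 X2 Y2 sX _; apply: (WD S) => //; exact: legal_card legalS.
Qed.

End MakerClique.

Theorem theorem3p6 :
  (forall m b : nat, 0 < m -> 0 < b ->
    [/\ exists N0 : nat, forall N : nat, N0 <= N ->
          maker_clique N m b.+1 < maker_clique N m b /\
          maker_clique N m b < maker_clique N m.+1 b,
        tends_to_infinity
          (fun N => maker_clique N m b - maker_clique N m b.+1)
      & tends_to_infinity
          (fun N => maker_clique N m.+1 b - maker_clique N m b)]) ->
  forall p : nat, 0 < p ->
    exists n0 : nat, forall n : nat, n0 <= n ->
      player2_wins_clique_game n p (2 * p + 1).
Proof.
move=> gaps p p_gt0.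
(* A gap of [p.+1] leaves a strict inequality after the loss of [p] vertices from moving second. *)
have [_ /(_ p.+1)[n0 gap] _] := gaps p p p_gt0 p_gt0.
exists n0 => n /gap; rewrite ltn_subRL => {}gap.
have lt_n : maker_clique n p p.+1 < n.
  apply: leq_trans (maker_clique_le n p p).
  by apply: leq_ltn_trans gap; rewrite leq_addr.
rewrite /player2_wins_clique_game.
have -> : 2 * p + 1 = p + p.+1 by rewrite mul2n -addnn addn1 addnS.
have := forces_both p_gt0 (ltn0Sn p) p_gt0 _ _
  (maker_moves_second n p_gt0 p_gt0) (breaker_bounds_clique p_gt0 (ltn0Sn p) lt_n).
move=> both; apply: forces_weaken (both _ _); rewrite ?addn_gt0 ?p_gt0 //.
- move=> X1 Y1 X2 Y2 sX sY [leX leY].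
  (* With [p] added to both sides, the values [maker_clique n p p.+1 + p] and [maker_clique n p p]
     separate the two clique numbers. *)
  rewrite -(ltn_add2r p); apply: leq_trans (leq_trans leX _).
    apply: leq_ltn_trans gap; rewrite leq_add2r.
    exact: leq_trans (clique_number_le sY) leY.
  by rewrite leq_add2r clique_number_le.
- move=> X Y X' Y' sX _ leX; apply: leq_trans leX _.
  by rewrite leq_add2r clique_number_le.
- by move=> X Y X' Y' _ sY; apply: leq_trans (clique_number_le sY).
Qed.
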